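(* Let $\mathcal{C}\subseteq\mathbb{F}_q^n$ be a linear code of length $n$, dimension $k\ge1$ and minimum distance $d\ge2$, with rate satisfying $\frac{k}{n}>\big(1-\frac{1}{\sqrt n}\big)^2$, and let $J=n-k-d+2$. For $\theta\in[0,d-2]$ put $a_\theta=n-\theta+J-J\lceil\frac{n-\theta}{J}\rceil$. Then the average locality of $\mathcal{C}$ satisfies $$\overline{r}\ \ge\ \frac{1}{n}\min_{\theta\in[0,d-2]}\left\{(J-a_\theta)\Big\lfloor\frac{n-\theta}{J}\Big\rfloor^2+a_\theta\Big\lceil\frac{n-\theta}{J}\Big\rceil^2+(n-dJ+2J)\theta\right\}-1 .$$
   Context: For a codeword $\mathbf{y}=(y_1,\dots,y_n)\in\mathcal{C}$, the locality $\mathrm{Loc}(y_i)$ of the $i$-th symbol is the smallest size of a set $\mathcal{I}\subseteq[1,n]\setminus\{i\}$ such that there are scalars $\alpha_l\in\mathbb{F}_q$ with $y_i=\sum_{l\in\mathcal{I}}\alpha_l y_l$ for every codeword $\mathbf{y}\in\mathcal{C}$. The average locality is $\overline{r}=\frac1n\sum_{i=1}^n\mathrm{Loc}(y_i)$. $[a,b]=\{a,\dots,b\}$. *)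

(* Defs.v *)
From HB Require Import structures.
From mathcomp Require Import all_boot all_order all_algebra all_field.
Set Implicit Arguments. Unset Strict Implicit. Unset Printing Implicit Defensive.
Import Order.TTheory GRing.Theory Num.Theory.

(* A linear code of length n over the finite field F is the row space of a
   matrix C : 'M[F]_(m, n); codewords are row vectors y with (y <= C)%MS. *)

Local Open Scope ring_scope.
Section Codes.
Variables (F : finFieldType) (m n : nat).

Definition codeword (C : 'M[F]_(m, n)) (y : 'rV[F]_n) : bool := (y <= C)%MS.

Definition wt (y : 'rV[F]_n) : nat := #|[set j : 'I_n | y 0 j != 0]|.

(* minimum distance = minimum weight of a nonzero codeword
   (default n.+1 if there is no nonzero codeword) *)
Definition min_dist (C : 'M[F]_(m, n)) : nat :=
  \big[minn/n.+1]_(y : 'rV[F]_n | codeword C y && (y != 0)) wt y.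

Definition recovers (C : 'M[F]_(m, n)) (i : 'I_n) (I : {set 'I_n}) : bool :=
  (i \notin I) &&
  [exists alpha : {ffun 'I_n -> F},
     [forall y : 'rV[F]_n, codeword C y ==> (y 0 i == \sum_(l in I) alpha l * y 0 l)]].

(* locality of the i-th symbol: smallest size of a recovering set
   (default n if none exists; never used under the hypotheses d >= 2) *)
Definition locality (C : 'M[F]_(m, n)) (i : 'I_n) : nat :=
  \big[minn/n]_(I : {set 'I_n} | recovers C i I) #|I|.

Definition avg_locality (C : 'M[F]_(m, n)) : algC :=
  (\sum_(i < n) locality C i)%:R / n%:R.

End Codes.

Local Open Scope ring_scope.

Definition Jpar (n k d : nat) : int := n%:Z - k%:Z - d%:Z + 2.

Definition floor_div (a b : int) : int := (a %/ b)%Z.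
Definition ceil_div (a b : int) : int := - ((- a) %/ b)%Z.

Definition a_theta (n k d theta : nat) : int :=
  let J := Jpar n k d in
  (n%:Z - theta%:Z) + J - J * ceil_div (n%:Z - theta%:Z) J.

Definition bound_term (n k d theta : nat) : int :=
  let J := Jpar n k d in
  let a := a_theta n k d theta in
  (J - a) * (floor_div (n%:Z - theta%:Z) J) ^+ 2
  + a * (ceil_div (n%:Z - theta%:Z) J) ^+ 2
  + (n%:Z - d%:Z * J + 2 * J) * theta%:Z.

Definition min_bound (n k d : nat) : int :=
  \big[Order.min/bound_term n k d 0]_(theta < d.-1) bound_term n k d theta.

(* Main.v *)
Require Import Defs.
From HB Require Import structures.
From mathcomp Require Import all_boot all_order all_algebra all_field.
From mathcomp Require Import zify ring.
Import Order.TTheory GRing.Theory Num.Theory.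

Set Implicit Arguments. Unset Strict Implicit. Unset Printing Implicit Defensive.

(** [Loc(y_i) + 1] is the least size of the support of a dual word through [i].
    Put [D = d - 2], so that [J + D = n - k].  By Frobenius' rank inequality, [J]
    independent dual words leave at most [D] coordinates uncovered.

    Choose supports [A_0, A_1, ...] greedily, each one smallest among those that
    reach an uncovered coordinate.  Then [Loc + 1 >= |A_j|] on the [N_j]
    coordinates that [A_j] newly covers, and the coordinates left uncovered after
    [J] steps, [theta <= D] in number, satisfy [Loc + 1 >= |w|] with [w = A_J].
    Write [|A_j| = N_j + e_j].

    If [sum e_j >= theta], the uncovered coordinates can be distributed over the
    [A_j] without exceeding the sizes [|A_j|], and the term [theta = 0] is a lower
    bound.  Otherwise, let [p_j] be the number of coordinates private to [A_j].
    Trading [A_j] for [w] still leaves at most [D] coordinates uncovered, so [w]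
    contains at least [p_j - D] of the private ones, and with the rate hypothesis
    [|w| >= theta + sum (p_j - D)^+].  As [e_j < theta <= D], in every case
    [N_j e_j + theta (p_j - D)^+ + theta D >= theta (e_j + p_j)]; summing over [j]
    and using [sum p_j >= sum N_j - sum e_j] gives
    [sum (Loc + 1) >= sum N_j^2 + theta (n - J D)].  The sum of squares is least
    when the [N_j] are balanced. *)

(** * Greedy coverings of a finite set *)

Lemma card_setU_disjoint (T : finType) (A B : {set T}) :
  A :&: B = set0 -> #|A :|: B| = #|A| + #|B|.
Proof. by move=> dAB; rewrite cardsU dAB cards0 subn0. Qed.

Section GreedyCover.
Variables (T : finType) (next : {set T} -> {set T}).

Definition covered (j : nat) : {set T} := iter j (fun U => U :|: next U) set0.

Arguments covered : simpl never.

Definition block (j : nat) : {set T} := next (covered j).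

Lemma coveredS j : covered j.+1 = covered j :|: block j.
Proof. by []. Qed.

Lemma covered_mono i j : i <= j -> covered i \subset covered j.
Proof.
elim: j => [|j IH]; first by rewrite leqn0 => /eqP->.
rewrite leq_eqVlt => /orP[/eqP->//|lt_ij].
by rewrite coveredS; apply: subset_trans (IH lt_ij) (subsetUl _ _).
Qed.

Lemma block_covered i j : i < j -> block i \subset covered j.
Proof.
by move=> /covered_mono; apply: subset_trans; rewrite coveredS subsetUr.
Qed.

(** The newly covered parts [block i :\: covered i], for [i < j], partition [covered j]. *)
Lemma sum_block_new (X : {set T}) j :
  \sum_(i < j) #|(block i :\: covered i) :&: X| = #|covered j :&: X|.
Proof.
elim: j => [|j IH]; first by rewrite big_ord0 set0I cards0.
rewrite big_ord_recr /= IH coveredS -card_setU_disjoint.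
  by apply: eq_card => x; rewrite !inE; case: (x \in covered j); case: (x \in X).
by apply/setP=> x; rewrite !inE; case: (x \in covered j); rewrite ?andbF.
Qed.

Lemma sum_card_block_new j : \sum_(i < j) #|block i :\: covered i| = #|covered j|.
Proof.
by rewrite -[covered j in RHS]setIT -sum_block_new; apply: eq_bigr => i _; rewrite setIT.
Qed.

End GreedyCover.

(** * The counting bound for greedy coverings *)

Lemma exists_sub_sum (I : finType) (e : I -> nat) theta :
  theta <= \sum_i e i ->
  exists a : I -> nat, (forall i, a i <= e i) /\ \sum_i a i = theta.
Proof.
elim: theta => [|t IH] le_t; first by exists (fun=> 0); split=> //; rewrite big1.
have [a [le_ae sum_a]] := IH (ltnW le_t).
have /existsP[i lt_i] : [exists i, a i < e i].
  apply: contraLR le_t; rewrite negb_exists => /forallP le_ea.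
  rewrite -leqNgt -sum_a; apply: leq_sum => i _.
  by rewrite leqNgt; apply: le_ea.
exists (fun l => a l + (l == i)); split=> [l|].
  by case: eqP => [->|_]; rewrite ?addn1 ?addn0.
rewrite big_split /= sum_a -addn1; congr (_ + _).
by rewrite (bigD1 i) //= eqxx big1 ?addn0 // => l /negPf->.
Qed.

Section Combinatorics.
Variables (T : finType) (P : pred {set T}) (s : T -> nat) (J D : nat).

(** In use, [P] is [dual_supp C] and [s] is one more than the locality; with [s_min] this makes
    [s x] an attained minimum. *)
Hypothesis has_block : forall x, exists A : {set T}, [/\ P A, x \in A & #|A| <= s x].
Hypothesis s_min : forall (A : {set T}) x, P A -> x \in A -> s x <= #|A|.

(* [rho] is the order in which the sets come; [x i] witnesses that [B i] is
   not covered by the earlier ones. *)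
Hypothesis fresh_cover : forall (B : 'I_J -> {set T}) (x : 'I_J -> T) (rho : 'I_J -> nat),
  injective rho -> (forall i, P (B i)) -> (forall i, x i \in B i) ->
  (forall i j, rho i < rho j -> x j \notin B i) ->
  forall U : {set T}, (forall i, [disjoint U & B i]) -> #|U| <= D.

Hypothesis rate : (J + D + 1) ^ 2 < 4 * #|T|.

Let good (U A : {set T}) :=
  [&& P A, ~~ (A \subset U) & [forall (x | x \notin U), #|A| <= s x]].

Let next (U : {set T}) : {set T} := odflt set0 [pick A | good U A].

(** Among the uncovered points take [x] with [s x] least; a block of size at most [s x] through [x]
    is good. *)
Lemma good_next U : U != setT -> good U (next U).
Proof.
move=> neUT; rewrite /next; case: pickP => //= no_good.
have /subsetPn[x0 _ Ux0] : ~~ ([set: T] \subset U) by rewrite subTset.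
have [x /= Ux le_x] := @arg_minnP _ x0 (fun x => x \notin U) s Ux0.
have [A [PA Ax leA]] := has_block x.
have := no_good A; rewrite /good PA /= => /negbT; rewrite negb_and negbK.
case/orP=> [/subsetP/(_ x Ax)|/negP[]]; first by rewrite (negPf Ux).
by apply/forallP=> y; apply/implyP=> Uy; apply: leq_trans leA (le_x _ Uy).
Qed.

Let cov := covered next.
Let A := block next.
Let N j := #|A j :\: cov j|.
Let e j := #|A j :&: cov j|.

Let cardA j : #|A j| = N j + e j.
Proof. by rewrite -(cardsID (cov j) (A j)) addnC. Qed.

Lemma card_block_le_s j x : x \notin cov j -> #|A j| <= s x.
Proof.
move=> nx; have /good_next/and3P[_ _ /forallP/(_ x)/implyP/(_ nx)//] : cov j != setT.
by apply: contraNneq nx => ->.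
Qed.

(** The [N i] points that [A i] newly covers were uncovered when it was chosen, so [s] is at least
    [#|A i|] on them. *)
Lemma sum_s_covered j : \sum_(i < j) N i * #|A i| <= \sum_(x in cov j) s x.
Proof.
elim: j => [|j IH]; first by rewrite big_ord0.
rewrite big_ord_recr /= (big_setID (cov j)) /=.
rewrite (_ : cov j.+1 :&: cov j = cov j); last first.
  by apply/setIidPr/covered_mono.
rewrite (_ : cov j.+1 :\: cov j = A j :\: cov j); last first.
  by rewrite /cov coveredS setDUl setDv set0U.
apply: leq_add => //; rewrite -sum_nat_const.
by apply: leq_sum => x; rewrite inE => /andP[/card_block_le_s].
Qed.

Lemma sum_s_full : cov J = setT ->
  \sum_(i < J) N i = #|T| /\ \sum_(i < J) N i ^ 2 <= \sum_x s x.
Proof.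
move=> covT; split; first by rewrite sum_card_block_new -/cov covT cardsT.
have := sum_s_covered J; rewrite covT [leqRHS](eq_bigl predT); last first.
  by move=> x; rewrite inE.
apply: leq_trans; apply: leq_sum => i _.
by rewrite -mulnn leq_mul2l cardA leq_addr orbT.
Qed.

Section Partial.
Hypothesis cov_ne : cov J != setT.

Let w := A J.
Let theta := #|~: cov J|.

Let goodA j : j <= J -> good (cov j) (A j).
Proof.
move=> le_jJ; apply: good_next; apply: contraNneq cov_ne => covT.
by rewrite -subTset -covT covered_mono.
Qed.

Let PA j : j <= J -> P (A j).
Proof. by case/goodA/and3P. Qed.

Let fresh_ex j : {x | j <= J -> (x \in A j) && (x \notin cov j)}.
Proof.
(* Beyond [J] any point serves; one exists because [cov J] is not everything. *)
have [le_jJ|_] := leqP j J; last first.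
  suff /set0Pn/sigW[x _] : [set: T] != set0 by exists x.
  by apply: contraNneq cov_ne => T0; rewrite -subTset T0 sub0set.
have /and3P[_ /subsetPn/sig2W[x Ax nx] _] := goodA le_jJ.
by exists x => _; rewrite Ax.
Qed.

Let fresh j : T := sval (fresh_ex j).

Let fresh_block j : j <= J -> fresh j \in A j.
Proof. by move=> le_jJ; case/andP: (svalP (fresh_ex j) le_jJ). Qed.

Let fresh_new i j : i < j -> j <= J -> fresh j \notin A i.
Proof.
move=> lt_ij le_jJ; case/andP: (svalP (fresh_ex j) le_jJ) => _.
by apply: contra; apply/subsetP/block_covered.
Qed.

Lemma card_uncovered_le : theta <= D.
Proof.
apply: (@fresh_cover (fun i => A i) (fun i => fresh i) val); first exact: val_inj.
- by move=> i; apply/PA/ltnW.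
- by move=> i; apply/fresh_block/ltnW.
- by move=> i j lt_ij; apply: fresh_new (ltnW _).
by move=> i; rewrite disjoint_sym -subsets_disjoint; apply: block_covered.
Qed.

(** A point of [w] outside [cov J] was already uncovered at step [j], when [A j] was chosen
    smallest. *)
Lemma card_block_le_last j : j <= J -> #|A j| <= #|w|.
Proof.
move=> le_jJ; case/and3P: (goodA (leqnn J)) => PAJ /subsetPn[x Ax nx] _.
apply: leq_trans (s_min PAJ Ax); apply: card_block_le_s.
by apply: contra nx; apply/subsetP/covered_mono.
Qed.

Lemma sum_s_ge : \sum_(i < J) N i * #|A i| + theta * #|w| <= \sum_x s x.
Proof.
rewrite [leqRHS](bigID (mem (cov J))) /=; apply: leq_add.
  exact: sum_s_covered.
rewrite /theta -sum_nat_const.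
rewrite (eq_bigl (fun x => x \notin cov J)); last by move=> x; rewrite inE.
by apply: leq_sum => x /card_block_le_s.
Qed.

Lemma sum_N_theta : \sum_(i < J) N i + theta = #|T|.
Proof. by rewrite sum_card_block_new -/cov cardsC. Qed.

(* The points of the first [J] blocks lying in at least two of them. *)
Let O := \bigcup_(i < J) (A i :&: cov i).
Let priv (j : nat) := (A j :\: cov j) :\: O.
Let p j := #|priv j|.

(** A newly covered point is private or lies in [O], and the [e i] sum to at least [#|O|]. *)
Lemma sum_overlap_le : \sum_(i < J) N i <= \sum_(i < J) e i + \sum_(i < J) p i.
Proof.
rewrite (eq_bigr (fun i : 'I_J => #|(A i :\: cov i) :&: O| + p i)); last first.
  by move=> i _; rewrite /N -(cardsID O).
rewrite big_split leq_add2r sum_block_new.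
apply: leq_trans (subset_leq_card (subsetIr _ _)) _.
rewrite /O; elim/big_rec2: _ => [|i m X _ le_X]; first by rewrite cards0.
by apply: leq_trans (leq_card_setU _ _) _; rewrite leq_add2l.
Qed.

Lemma priv_notin i j x : i < J -> x \in priv j -> i != j -> x \notin A i.
Proof.
move=> lt_iJ; rewrite !inE => /and3P[nO ncov xj]; rewrite neq_ltn => /orP[lt_ij|lt_ji].
  by apply: contra ncov; apply/subsetP/block_covered.
apply: contra nO => xi; apply/bigcupP; exists (Ordinal lt_iJ) => //=.
by rewrite inE xi (subsetP (block_covered _ lt_ji)).
Qed.

(* Trade [A j] for [w]: the new [J] blocks miss both the private points of
   [A j] and the uncovered points that lie outside [w]. *)
Lemma card_priv_last (j : 'I_J) : #|priv j :\: w| + #|~: cov J :\: w| <= D.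
Proof.
have -> : #|priv j :\: w| + #|~: cov J :\: w| =
    #|(priv j :\: w) :|: (~: cov J :\: w)|.
  rewrite card_setU_disjoint //.
  apply/setP=> x; rewrite !inE; apply/negP=> /andP[/andP[_ /and3P[_ _ xj]] /andP[_]].
  by rewrite (subsetP (block_covered _ (ltn_ord j))).
(* [pos] puts [w = A J] in the place of [A j] and also serves as the order [rho], in which [w] comes
   last. *)
pose pos (i : 'I_J) : nat := if i == j then J else i.
have pos_le i : pos i <= J by rewrite /pos; case: eqP => // _; apply: ltnW.
apply: (@fresh_cover (fun i => A (pos i)) (fun i => fresh (pos i)) pos).
- move=> i1 i2; rewrite /pos; do 2![case: eqP => [->|_]] => //.
  + by move=> eqJ; have := ltn_ord i2; rewrite -eqJ ltnn.
  + by move=> eqJ; have := ltn_ord i1; rewrite eqJ ltnn.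
  + exact: val_inj.
- by move=> i; apply: PA.
- by move=> i; apply: fresh_block.
- by move=> i1 i2 lt12; apply: fresh_new.
move=> i; apply/pred0P=> x /=; apply/negP=> /andP[]; rewrite inE => Hx.
rewrite /pos; case: eqP => [_|/eqP neij] xA.
  by move: Hx; rewrite !inE -/w in xA *; rewrite [x \in w]xA.
case/orP: Hx => /setDP[Hx _].
  by move: xA; apply/negP; apply: priv_notin Hx _.
by move: Hx; rewrite inE (subsetP (block_covered _ (ltn_ord i))).
Qed.

(** With [u] uncovered points outside [w], [w] has [theta - u] points outside [cov J], and by
    [card_priv_last] at least [p i + u - D] in each of the disjoint private parts. *)
Lemma card_last_ge :
  theta + \sum_(i < J) (p i + #|~: cov J :\: w| - D)
    <= #|w| + #|~: cov J :\: w|.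
Proof.
set u := #|~: cov J :\: w|.
have theta_u : theta = #|w :\: cov J| + u.
  rewrite /theta -(cardsID w (~: cov J)); congr (_ + _); apply: eq_card => x.
  by rewrite !inE andbC.
have le_cov : \sum_(i < J) (p i + u - D) <= #|w :&: cov J|.
  rewrite setIC -sum_block_new; apply: leq_sum => i _.
  have := card_priv_last i; rewrite -/u.
  have := cardsID w (priv i); rewrite -/(p i).
  have : #|priv i :&: w| <= #|(block next i :\: covered next i) :&: w|.
    by apply/subset_leq_card/setSI/subsetDl.
  lia.
have := cardsID (cov J) w; lia.
Qed.

Lemma N_le_last (i : 'I_J) : N i <= #|w|.
Proof.
apply: leq_trans (card_block_le_last (ltnW (ltn_ord i))).
by rewrite cardA leq_addr.
Qed.

(** If [#|w| < theta <= D], then each [N i <= D - 1], so [#|T| <= J (D - 1) + D]. By the AM-GM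
    inequality four times this is at most [(J + D + 1) ^ 2], against [rate]. *)
Lemma theta_le_last : theta <= #|w|.
Proof.
rewrite leqNgt; apply/negP=> lt_w.
have leN : \sum_(i < J) N i <= J * #|w|.
  rewrite -[J in J * _]card_ord -sum_nat_const.
  by apply: leq_sum => i _; apply: N_le_last.
have := sum_N_theta; have := card_uncovered_le; have := rate.
move: leN lt_w; move: (\sum_(i < J) N i) theta #|w| #|T| => S t v n.
move=> leS lt_vt rt le_t eq_n.
have [D' eqD] : exists D', D = D'.+1 by exists D.-1; lia.
have := (nat_AGM2 J D').1; rewrite eqD in rt le_t; rewrite -!mulnn in rt *.
have : J * v <= J * D' by rewrite leq_mul2l; lia.
nia.
Qed.

(** If some [p j >= D], its term in [card_last_ge] absorbs [u]; otherwise the sum vanishes and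
    [theta_le_last] suffices. *)
Lemma last_ge : theta + \sum_(i < J) (p i - D) <= #|w|.
Proof.
have := card_last_ge; set u := #|~: cov J :\: w| => le_w.
have [/existsP[j le_Dp]|] := boolP [exists j : 'I_J, D <= p j]; last first.
  rewrite negb_exists => /forallP lt_p.
  rewrite big1 ?addn0 ?theta_le_last // => i _.
  by have := lt_p i; lia.
suff : \sum_(i < J) (p i - D) + u <= \sum_(i < J) (p i + u - D) by lia.
rewrite (bigD1 j) //= [X in _ <= X](bigD1 j) //= addnAC.
apply: leq_add; first by lia.
by apply: leq_sum => i _; lia.
Qed.

Lemma partial_bound : exists t (M : 'I_J -> nat),
  [/\ t <= D, \sum_i M i + t = #|T| &
      \sum_i M i ^ 2 + t * #|T| <= \sum_x s x + t * (J * D)].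
Proof.
have [le_e|lt_e] := leqP theta (\sum_(i < J) e i).
  (* Hand each uncovered point to a block with room left: all sizes are then
     at most [#|A i|], and no cost increases. *)
  have [a [le_a sum_a]] := exists_sub_sum le_e.
  exists 0, (fun i : 'I_J => N i + a i); split=> //.
    by rewrite big_split /= sum_a addn0 sum_N_theta.
  rewrite !mul0n !addn0; apply: leq_trans sum_s_ge.
  rewrite -sum_a big_distrl /= -big_split /=; apply: leq_sum => i _.
  have := card_block_le_last (ltnW (ltn_ord i)); have := le_a i; rewrite cardA -mulnn.
  nia.
exists theta, (fun i : 'I_J => N i); split.
- exact: card_uncovered_le.
- exact: sum_N_theta.
(* Write [e], [p], [N] at [i]. If [p >= D], use [N >= p >= D >= theta]. Otherwise use [N >= p] and
   [p e + theta D - theta (e + p) = (theta - e) (D - p) + e (D - theta)]. *)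
have le_each : \sum_(i < J) (theta * (e i + p i))
    <= \sum_(i < J) (N i * e i + theta * (p i - D) + theta * D).
  apply: leq_sum => i _.
  have le_ei : e i < theta.
    by apply: leq_ltn_trans lt_e; rewrite (bigD1 i) //= leq_addr.
  have le_p : p i <= N i by apply/subset_leq_card/subsetDl.
  have := card_uncovered_le; nia.
have := sum_s_ge; rewrite [X in X + _](eq_bigr (fun i : 'I_J => N i ^ 2 + N i * e i)).
  2: by move=> i _; rewrite cardA mulnDr mulnn.
move: le_each; rewrite !big_split /= -!big_distrr /= big_split /=.
rewrite sum_nat_const card_ord => le_each le_s.
have := leq_mul (leqnn theta) last_ge; have := leq_mul (leqnn theta) sum_overlap_le.
rewrite -sum_N_theta !mulnDr.
move: le_each le_s; rewrite !mulnDr (mulnCA theta J D).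
move: (J * _) (theta * #|w|) (\sum_x s x) => v1 v2 v3.
move: (theta * \sum_(i < J) e i) (theta * \sum_(i < J) p i) => v4 v5.
move: (theta * \sum_(i < J) (p i - D)) (theta * \sum_(i < J) N i) => v6 v7.
move: (theta * theta) (\sum_(i < J) N i ^ 2) (\sum_(i < J) N i * e i) => v8 v9 v10.
lia.
Qed.

End Partial.

Lemma greedy_bound : exists t (M : 'I_J -> nat),
  [/\ t <= D, \sum_i M i + t = #|T| &
      \sum_i M i ^ 2 + t * #|T| <= \sum_x s x + t * (J * D)].
Proof.
have [/eqP/sum_s_full[sumN le_s]|/partial_bound//] := boolP (cov J == setT).
by exists 0, (fun i : 'I_J => N i); rewrite !mul0n !addn0.
Qed.

End Combinatorics.

Local Open Scope ring_scope.

(** * Dual words, their supports and ranks *)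

Lemma exists_subset_card (T : finType) (A : {set T}) c :
  (c <= #|A|)%N -> exists2 Z : {set T}, Z \subset A & #|Z| = c.
Proof.
elim: c => [|c IH] le_c; first by exists set0; rewrite ?sub0set ?cards0.
have [Z sZA cardZ] := IH (ltnW le_c).
have /subsetPn[x Ax nZx] : ~~ (A \subset Z).
  by apply: contraL le_c => /subset_leq_card; rewrite cardZ -leqNgt.
by exists (x |: Z); rewrite ?subUset ?sub1set ?Ax // cardsU1 nZx cardZ.
Qed.

Section DualWords.
Variables (F : finFieldType) (m n : nat) (C : 'M[F]_(m, n)).

Definition supp (h : 'rV[F]_n) : {set 'I_n} := [set j | h 0 j != 0].

Definition dual_word (h : 'rV[F]_n) : bool := h *m C^T == 0.

Definition dual_supp (A : {set 'I_n}) : bool :=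
  [exists h : 'rV[F]_n, dual_word h && (supp h == A)].

Lemma dual_suppP A :
  reflect (exists2 h, dual_word h & supp h = A) (dual_supp A).
Proof.
apply: (iffP existsP) => [[h /andP[dh /eqP sh]]|[h dh sh]]; first by exists h.
by exists h; rewrite dh sh eqxx.
Qed.

Lemma dual_word_orth h y : dual_word h -> codeword C y -> \sum_l h 0 l * y 0 l = 0.
Proof.
move=> /eqP dh /submxP[v ->].
have -> : \sum_l h 0 l * (v *m C) 0 l = (h *m (v *m C)^T) 0 0.
  by rewrite mxE; apply: eq_bigr => l _; rewrite [in RHS]mxE.
by rewrite trmx_mul mulmxA dh mul0mx mxE.
Qed.

Lemma recovers_dual i I : recovers C i I ->
  exists A, [/\ dual_supp A, i \in A & (#|A| <= #|I|.+1)%N].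
Proof.
case/andP=> iI /existsP[alpha /forallP rec].
pose h : 'rV[F]_n := \row_l ((l == i)%:R - (l \in I)%:R * alpha l).
exists (supp h); split.
- apply/dual_suppP; exists h => //; apply/eqP/rowP=> a; rewrite !mxE.
  have /implyP/(_ (row_sub a C))/eqP := rec (row a C).
  rewrite !mxE => eq_i.
  under eq_bigr => l _ do rewrite !mxE mulrBl.
  rewrite sumrB (bigD1 i) //= eqxx mul1r big1 ?addr0; last first.
    by move=> l /negPf->; rewrite mul0r.
  rewrite eq_i [X in X - _]big_mkcond; apply/eqP; rewrite subr_eq0; apply/eqP.
  apply: eq_bigr => l _; rewrite mxE.
  by case: (l \in I); rewrite ?mul1r ?mul0r.
- by rewrite !inE mxE eqxx (negPf iI) mul0r subr0 oner_eq0.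
apply: leq_trans (_ : #|i |: I| <= _)%N; last by rewrite cardsU1 iI.
apply/subset_leq_card/subsetP=> l; rewrite !inE mxE.
by case: (l == i) => //; case: (l \in I) => //; rewrite mul0r subr0 eqxx.
Qed.

Lemma dual_recovers A i : dual_supp A -> i \in A -> recovers C i (A :\ i).
Proof.
case/dual_suppP=> h dh <-; rewrite inE => hi; rewrite /recovers !inE eqxx /=.
apply/existsP; exists [ffun l => - (h 0 l / h 0 i)]; apply/forallP=> y.
apply/implyP=> Cy; have /eqP := dual_word_orth dh Cy.
rewrite (bigD1 i) //= (bigID (mem (supp h))) /= [X in _ + (_ + X)]big1 ?addr0; last first.
  by move=> l /andP[_]; rewrite inE negbK => /eqP->; rewrite mul0r.
rewrite addr_eq0 => /eqP eq_i.
apply/eqP/(mulfI hi); rewrite eq_i mulr_sumr -sumrN.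
apply: eq_big => l; first by rewrite !inE.
by move=> _; rewrite ffunE; field.
Qed.

Lemma locality_lt_supp A i : dual_supp A -> i \in A -> (locality C i < #|A|)%N.
Proof.
move=> dA Ai; rewrite (cardsD1 i A) Ai /locality ltnS.
exact: (@bigmin_le_cond _ nat _ _ _ _ (fun I : {set 'I_n} => #|I|)
          (dual_recovers dA Ai)).
Qed.

Lemma min_dist_le y : codeword C y -> y != 0 -> (min_dist C <= wt y)%N.
Proof.
move=> Cy y0; rewrite /min_dist.
have P : codeword C y && (y != 0) by rewrite Cy.
exact: (@bigmin_le_cond _ nat _ _ _ _ (@wt F n) P).
Qed.

(** Distance at least 2 keeps the unit vector at [i] out of the code, so a column of [cokermx C] is
    a dual word through [i]. Hence [i] has a recovering set, and a smallest one yields [A]. *)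
Lemma locality_supp i : (2 <= min_dist C)%N ->
  exists A, [/\ dual_supp A, i \in A & (#|A| <= (locality C i).+1)%N].
Proof.
move=> d2.
have [A0 dA0 iA0] : exists2 A, dual_supp A & i \in A.
  have [e_i|] := boolP (codeword C (delta_mx 0 i)).
    have := min_dist_le e_i; rewrite (_ : wt _ = 1%N).
      suff nz : delta_mx 0 i != 0 :> 'rV[F]_n by move=> /(_ nz)/(leq_trans d2).
      by apply/eqP=> /rowP/(_ i)/eqP; rewrite !mxE !eqxx oner_eq0.
    rewrite /wt -[RHS](cards1 i); apply: eq_card => j; rewrite !inE !mxE eqxx /=.
    by case: (j == i); rewrite ?oner_eq0 ?eqxx.
  have := mulmx_coker C; rewrite /codeword submxE; move: (cokermx C) => K CK.
  move=> /matrix0Pn[a [j]]; rewrite -rowE mxE => nz.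
  exists (supp (col j K)^T); last by rewrite !inE !mxE.
  apply/dual_suppP; exists (col j K)^T => //.
  by rewrite /dual_word -trmx_mul colE mulmxA CK mul0mx trmx0.
have recA0 := dual_recovers dA0 iA0.
have [I recI le_I] := @arg_minnP _ _ (recovers C i) (fun I => #|I|) recA0.
have [A [dA iA leA]] := recovers_dual recI.
exists A; split=> //; apply: leq_trans leA _; rewrite ltnS /locality.
elim/big_rec: _ => [|I' x /le_I le1 le2]; last by rewrite leq_min le1.
by rewrite -[leqRHS]card_ord max_card.
Qed.

(* Frobenius' rank inequality through the coordinate projection away from [Z],
   which is injective on [C] because [#|Z|] is smaller than the distance. *)
Lemma rank_dual_avoiding (r : nat) (H : 'M[F]_(r, n)) (Z : {set 'I_n}) :
  H *m C^T = 0 -> (forall i j, j \in Z -> H i j = 0) -> (#|Z| < min_dist C)%N ->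
  (\rank C + \rank H + #|Z| <= n)%N.
Proof.
move=> HC HZ ltZ.
pose p : 'rV[F]_n := \row_j (j \notin Z)%:R.
have HP : H *m diag_mx p = H.
  apply/matrixP=> i j; rewrite mul_mx_diag !mxE.
  by case: (boolP (j \in Z)) => [/HZ->|_]; rewrite ?mul0r ?mulr1.
have rankP : (\rank (diag_mx p) + #|Z| <= n)%N.
  rewrite -[leqRHS](card_ord n) -(cardC (mem Z)) addnC leq_add2l diag_mx_sum_delta.
  rewrite (bigID (fun i => i \notin Z)) /= [X in (_ + X)%R]big1 ?addr0; last first.
    by move=> i /negbTE nZ; rewrite mxE nZ scale0r.
  pose R i := \rank (p 0 i *: delta_mx i i : 'M[F]_n).
  apply: leq_trans (_ : \sum_(i | i \notin Z) R i <= _)%N.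
    elim/big_rec2: _ => [|i x A _ le_x]; first by rewrite mxrank0.
    by apply: leq_trans (mxrank_add _ _) _; rewrite leq_add2l.
  rewrite -sum1_card; apply: leq_sum => i _.
  by apply: leq_trans (mxrank_scale _ _) _; rewrite mxrank_delta.
have rankCP : \rank (diag_mx p *m C^T) = \rank C.
  rewrite -mxrank_tr trmx_mul trmxK tr_diag_mx -(mxrank_mul_ker C (diag_mx p)).
  rewrite (_ : (C :&: kermx (diag_mx p))%MS = 0) ?mxrank0 ?addn0 //.
  apply/eqP/rowV0P=> y; rewrite sub_capmx => /andP[Cy /sub_kermxP yP].
  apply/eqP/negPn/negP=> /(min_dist_le Cy)/(leq_trans ltZ); rewrite ltnNge => /negP[].
  apply/subset_leq_card/subsetP=> j; rewrite inE; apply: contraR => jZ.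
  by move/rowP/(_ j)/eqP: yP; rewrite mul_mx_diag !mxE jZ mulr1.
have := mxrank_Frobenius H (diag_mx p) C^T.
rewrite rankCP HP HC mxrank0; lia.
Qed.

(** This is [rank_dual_avoiding] with no dual words and [min_dist C - 1] avoided coordinates. *)
Lemma singleton_bound : (0 < min_dist C)%N -> (0 < \rank C)%N ->
  (\rank C + min_dist C <= n.+1)%N.
Proof.
move=> d0 k0.
have [y Cy y0] : exists2 y : 'rV_n, (y <= C)%MS & y != 0.
  by apply/rowV0Pn; rewrite -mxrank_eq0 -lt0n.
have le_n : (min_dist C <= n)%N.
  by apply: leq_trans (min_dist_le Cy y0) _; rewrite -[leqRHS]card_ord max_card.
have [Z _ cardZ] : exists2 Z : {set 'I_n}, Z \subset setT & #|Z| = (min_dist C).-1.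
  by apply: exists_subset_card; rewrite cardsT card_ord; lia.
have := @rank_dual_avoiding 0 0 Z; rewrite mul0mx mxrank0 cardZ.
have zero i j : j \in Z -> (0 : 'M[F]_(0, n)) i j = 0 by rewrite mxE.
by move=> /(_ erefl zero); lia.
Qed.

(** In a vanishing combination let [j] be the [rho]-last index with nonzero coefficient: at
    coordinate [x j] only [h j] contributes. *)
Lemma row_free_fresh (r : nat) (h : 'I_r -> 'rV[F]_n) (x : 'I_r -> 'I_n)
    (rho : 'I_r -> nat) :
  injective rho -> (forall i, x i \in supp (h i)) ->
  (forall i j, (rho i < rho j)%N -> x j \notin supp (h i)) ->
  row_free (\matrix_i h i).
Proof.
move=> rho_inj xh fresh; apply: inj_row_free => v vH.
apply/eqP/negPn/negP=> /matrix0Pn[a [j0]]; rewrite ord1 => {a} vj0.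
have [j vj max_j] := @arg_maxnP _ j0 (fun j => v 0 j != 0) rho vj0.
move/rowP/(_ (x j))/eqP: vH; rewrite !mxE (bigD1 j) //= big1 ?addr0.
  by move: (xh j); rewrite inE mxE mulf_eq0 (negPf vj) /= => /negPf->.
move=> i ne_ij; rewrite mxE.
have [lt_ij|lt_ji|/rho_inj eq_ij] := ltngtP (rho i) (rho j).
- by have := fresh _ _ lt_ij; rewrite inE negbK => /eqP->; rewrite mulr0.
- have [->|/max_j] := eqVneq (v 0 i) 0; first by rewrite mul0r.
  by move=> /(leq_trans lt_ji); rewrite ltnn.
- by rewrite eq_ij eqxx in ne_ij.
Qed.

Lemma dual_supp_cover (r : nat) (B : 'I_r -> {set 'I_n}) (x : 'I_r -> 'I_n)
    (rho : 'I_r -> nat) :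
  injective rho -> (forall i, dual_supp (B i)) -> (forall i, x i \in B i) ->
  (forall i j, (rho i < rho j)%N -> x j \notin B i) ->
  forall U : {set 'I_n}, (forall i, [disjoint U & B i]) ->
  (#|U| < min_dist C)%N -> (\rank C + r + #|U| <= n)%N.
Proof.
move=> rho_inj dB xB fresh U dU ltU.
have /fin_all_exists2[h dh sh] i : exists2 h, dual_word h & supp h = B i.
  exact/dual_suppP.
have /eqP <- : row_free (\matrix_i h i).
  by apply: (@row_free_fresh _ _ x rho) => // [i|i j]; rewrite sh //; exact: fresh.
apply: rank_dual_avoiding => //.
  apply/row_matrixP=> i; rewrite row_mul rowK row0; apply/eqP; exact: dh.
move=> i j Uj; rewrite mxE; apply/eqP; have := disjointFr (dU i) Uj.
by rewrite -sh inE => /negbT; rewrite negbK.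
Qed.

End DualWords.

(** * Balanced sums of squares and the rate condition *)

Lemma balanced_sum_sqr (J : nat) (M : 'I_J -> nat) (S a : int) :
  (0 < J)%N -> S = (\sum_i M i)%N%:Z ->
  a = S + J%:Z - J%:Z * ceil_div S J%:Z ->
  (J%:Z - a) * floor_div S J%:Z ^+ 2 + a * ceil_div S J%:Z ^+ 2
    <= (\sum_i M i ^ 2)%N%:Z.
Proof.
move=> J0 defS ->; rewrite /floor_div /ceil_div.
set q := (S %/ J)%Z; set c := - (- S %/ J)%Z.
have SE := divz_eq S J%:Z; rewrite -/q in SE.
have [r0 rJ] : 0 <= (S %% J)%Z /\ (S %% J)%Z < J%:Z.
  by split; [apply: modz_ge0; lia | apply: ltz_pmod; lia].
have SN := divz_eq (- S) J%:Z.
have [r0' rJ'] : 0 <= (- S %% J)%Z /\ (- S %% J)%Z < J%:Z.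
  by split; [apply: modz_ge0; lia | apply: ltz_pmod; lia].
have cE : (- S %/ J)%Z = - c by rewrite opprK.
rewrite cE in SN.
(* [(x - q) (x - (q + 1)) >= 0] for every integer [x]. *)
have tangent : (2 * q + 1) * S - J%:Z * (q * (q + 1)) <= (\sum_i M i ^ 2)%N%:Z.
  have -> : J%:Z * (q * (q + 1)) = \sum_(i < J) q * (q + 1).
    by rewrite sumr_const card_ord -mulr_natl natz.
  have -> : S = \sum_i (M i)%:Z.
    by rewrite defS -[LHS]intz sumMz; apply: eq_bigr => i _; rewrite intz.
  have -> : (\sum_i M i ^ 2)%N%:Z = \sum_i (M i)%:Z ^+ 2.
    by rewrite -[LHS]intz sumMz; apply: eq_bigr => i _; rewrite intz -mulnn PoszM.
  rewrite mulr_sumr -sumrB; apply: ler_sum => i _.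
  move: (M i)%:Z => x; have [|] := leP x q; nia.
apply: le_trans tangent.
(* If [J] divides [S], then [c = q] and [a = J]; otherwise [c = q + 1] and [a] is the remainder.
   Either way the parts of the balanced distribution are [q] or [q + 1], where the tangent
   inequality is an equality. *)
have [eq_c|eq_c] : c = q \/ c = q + 1 by nia.
- have -> : S = J%:Z * q by nia.
  by rewrite eq_c; nia.
by rewrite eq_c; nia.
Qed.

(** Multiplying by [n] gives [(sqrt n - 1) ^ 2 < k], that is [n - k + 1 < 2 sqrt n], which is then
    squared. *)
Lemma rate_nat (n k : nat) : (k <= n)%N ->
  (1 - 1 / sqrtC (n%:R : algC)) ^+ 2 < k%:R / n%:R ->
  ((n - k + 1) ^ 2 < 4 * n)%N.
Proof.
move=> le_kn.
(* At [n = 0] inverses of zero are zero, and the hypothesis reads [1 < 0]. *)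
case: (posnP n) => [->|n0]; first by rewrite sqrtC0 !invr0 !mulr0 subr0 expr1n ltr10.
set r := sqrtC _ => rate.
have rr : r ^+ 2 = n%:R by rewrite sqrtCK.
have r0 : 0 < r by rewrite sqrtC_gt0 ltr0n.
have lt_r : (n - k + 1)%:R < 2 * r.
  move: rate; rewrite ltr_pdivlMr ?ltr0n // -rr -exprMn mulrBl mul1r.
  rewrite mul1r mulVf ?gt_eqF // sqrrB1 rr => rate.
  rewrite natrD natrB // -subr_gt0; rewrite -subr_gt0 in rate.
  by congr (_ < _): rate; ring.
rewrite -(ltr_nat algC) natrX natrM -rr.
have -> : (4%:R : algC) * r ^+ 2 = (2 * r) ^+ 2 by ring.
by rewrite ltr_sqr // nnegrE ?ler0n // mulr_ge0 // ltW.
Qed.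

(** * From the greedy bound to the average locality *)

Theorem theorem2 (F : finFieldType) (m n k d : nat) (C : 'M[F]_(m, n))
  (hk : \rank C = k) (hk1 : (1 <= k)%N)
  (hd : min_dist C = d) (hd2 : (2 <= d)%N)
  (hrate : (1 - 1 / sqrtC (n%:R : algC)) ^+ 2 < k%:R / n%:R) :
  (min_bound n k d)%:~R / (n%:R : algC) - 1 <= avg_locality C.
Proof.
have le_kn : (k <= n)%N by rewrite -hk rank_leq_col.
have le_kd : (k + d <= n.+1)%N.
  by rewrite -hk -hd; apply: singleton_bound; rewrite ?hk ?hd // ltnW.
(* By the Singleton bound this subtraction is exact and [J >= 1]; also [J + D = n - k]. *)
pose J := (n + 2 - k - d)%N; pose D := (d - 2)%N.
have JE : Jpar n k d = J%:Z by rewrite /Jpar /J; lia.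
have rate : ((J + D + 1) ^ 2 < 4 * #|'I_n|)%N.
  rewrite card_ord; have := rate_nat le_kn hrate.
  by rewrite (_ : J + D + 1 = n - k + 1)%N // /J /D; lia.
have has_block (x : 'I_n) : exists A : {set 'I_n},
    [/\ dual_supp C A, x \in A & (#|A| <= (locality C x).+1)%N].
  by apply: locality_supp; rewrite hd.
have fresh_cover (B : 'I_J -> {set 'I_n}) (x : 'I_J -> 'I_n) (rho : 'I_J -> nat) :
    injective rho -> (forall i, dual_supp C (B i)) -> (forall i, x i \in B i) ->
    (forall i j, (rho i < rho j)%N -> x j \notin B i) ->
    forall U : {set 'I_n}, (forall i, [disjoint U & B i]) -> (#|U| <= D)%N.
  (* More than [d - 2] uncovered points would include a [Z] of size [d - 1], giving
     [k + J + (d - 1) <= n], whereas [k + J + d = n + 2]. *)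
  move=> rho_inj dB xB fresh U dU; rewrite leqNgt; apply/negP=> lt_D.
  have [|Z sZU cardZ] := @exists_subset_card _ U d.-1; first by rewrite /D in lt_D; lia.
  have dZ i : [disjoint Z & B i] by apply: disjointWl (dU i).
  have := dual_supp_cover rho_inj dB xB fresh dZ.
  by rewrite cardZ hk hd /J; lia.
have [t [M [le_tD sumM bound]]] :=
  greedy_bound has_block (fun A x => @locality_lt_supp F m n C A x) fresh_cover rate.
rewrite card_ord in sumM bound.
(* The [- 1] of the bound, as [- n / n], turns each locality into the support size
   [locality + 1]. *)
suff : min_bound n k d <= (\sum_(i < n) locality C i)%N%:Z + n%:Z.
  have n0 : 0 < n%:R :> algC by rewrite ltr0n; lia.
  rewrite -(ler_int algC) intrD => le_bound.
  rewrite /avg_locality lerBlDr -[X in _ <= _ + X](divff (lt0r_neq0 n0)).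
  by rewrite -mulrDl ler_pM2r ?invr_gt0.
have lt_t : (t < d.-1)%N by rewrite /D in le_tD; lia.
apply: le_trans (_ : bound_term n k d t <= _).
  exact: (@bigmin_le _ _ _ _ (Ordinal lt_t) (fun i : 'I_d.-1 => bound_term n k d i)).
have J0 : (0 < J)%N by rewrite /J; lia.
have defS : n%:Z - t%:Z = (\sum_i M i)%N%:Z by lia.
have := balanced_sum_sqr J0 defS erefl; rewrite /bound_term /a_theta JE.
move: (_ + _ * ceil_div _ _ ^+ 2) => X le_X.
have -> : (n%:Z - d%:Z * J%:Z + 2 * J%:Z) * t%:Z = (t * n)%N%:Z - (t * (J * D))%N%:Z.
  have -> : d%:Z = D%:Z + 2 by rewrite /D; lia.
  by rewrite !PoszM; ring.
move: bound; rewrite (eq_bigr (fun x => locality C x + 1)%N); last first.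
  by move=> x _; rewrite addn1.
rewrite big_split /= sum_nat_const card_ord muln1.
have combine (x : int) (a b u v : nat) :
    x <= a%:Z -> (a + u <= b + v)%N -> x + (u%:Z - v%:Z) <= b%:Z by lia.
exact: combine.
Qed.
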